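(* Let $\Gamma$ be a countable group. Every expansive principal algebraic $\Gamma$-action satisfies the pseudo-orbit tracing property.
   Context: For $f\in\mathbb{Z}\Gamma$ (the integral group ring), the principal algebraic action associated with $f$ is the action of $\Gamma$ on the compact metrizable abelian group $X_f:=\widehat{\mathbb{Z}\Gamma/\mathbb{Z}\Gamma f}$, the Pontryagin dual of the discrete left $\mathbb{Z}\Gamma$-module $\mathbb{Z}\Gamma/\mathbb{Z}\Gamma f$, by the continuous automorphisms dual to the module structure, $(g\cdot\chi)(m)=\chi(g^{-1}m)$. Let $\alpha=(\alpha_g)_{g\in\Gamma}$ be a continuous action on a compact metrizable space $X$ with compatible metric $d$. It is expansive if there is $c>0$ such that for all $x\ne y$ there is $g\in\Gamma$ with $d(\alpha_g(x),\alpha_g(y))>c$. For $S\subset\Gamma$ and $\delta>0$, an $(S,\delta)$ pseudo-orbit for $\alpha$ is a family $(x_g)_{g\in\Gamma}$ in $X$ such that $d(\alpha_s(x_g),x_{sg})<\delta$ for all $s\in S$ and $g\in\Gamma$; it is $\epsilon$-traced by $x\in X$ if $d(\alpha_g(x),x_g)<\epsilon$ for all $g\in\Gamma$. The action has the pseudo-orbit tracing property if for every $\epsilon>0$ there are $\delta>0$ and a finite set $S\subset\Gamma$ such that every $(S,\delta)$ pseudo-orbit is $\epsilon$-traced by some $x\in X$. *)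

(* Defs.v *)
From HB Require Import structures.
From mathcomp Require Import all_boot all_order all_algebra finmap.
From mathcomp Require Import generic_quotient.
From mathcomp Require Import all_classical all_reals topology.

Set Implicit Arguments.
Unset Strict Implicit.
Unset Printing Implicit Defensive.

Import Order.TTheory GRing.Theory Num.Theory.
Import numFieldTopology.Exports.

Local Open Scope classical_set_scope.
Local Open Scope ring_scope.

(* Elements of the integral group ring are finitely supported functions
   [Gamma -> int]; [a x] is the coefficient of [x] in [a]. *)
Definition group_ring (Gamma : groupType) : Type :=
  {fsfun Gamma -> int with 0%R}.

Section GroupRing.
Context {Gamma : groupType}.
Local Notation ZG := (group_ring Gamma).
Implicit Types (a b c : ZG) (x y g : Gamma) (S : {fset Gamma}).

HB.instance Definition _ :=
  Choice.copy (group_ring Gamma) {fsfun Gamma -> int with 0%R}.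

Definition gr_coef a : Gamma -> int := fun_of_fsfun a.

Definition gr_add a b : ZG :=
  [fsfun x in (finsupp a `|` finsupp b)%fset => gr_coef a x + gr_coef b x].

Definition gr_opp a : ZG := [fsfun x in finsupp a => - gr_coef a x].

Definition gr_zero : ZG := [fsfun].

Definition gr_delta g : ZG := [fsfun x in [fset g]%fset => 1].

(* Convolution: (a b)_x is the sum over y of a_y b_(y^-1 x); the index set
   [supp a * supp b] contains the support of the product. *)
Definition gr_mul a b : ZG :=
  [fsfun x in [fset (y * z)%g | y in finsupp a, z in finsupp b]%fset =>
     \sum_(y <- finsupp a) gr_coef a y * gr_coef b (y^-1 * x)%g].

Lemma gr_ext a b : (forall x, gr_coef a x = gr_coef b x) -> a = b.
Proof. by move=> ab; apply/fsfunP. Qed.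

Lemma gr_coef_notin a x : x \notin finsupp a -> gr_coef a x = 0.
Proof. exact: fsfun_dflt. Qed.

Lemma gr_addE a b x : gr_coef (gr_add a b) x = gr_coef a x + gr_coef b x.
Proof.
rewrite /gr_coef fsfunE in_fsetU; case: ifPn => //=.
by rewrite negb_or => /andP[/fsfun_dflt -> /fsfun_dflt ->].
Qed.

Lemma gr_oppE a x : gr_coef (gr_opp a) x = - gr_coef a x.
Proof.
rewrite /gr_coef fsfunE; case: ifPn => // /fsfun_dflt ->.
by rewrite oppr0.
Qed.

Lemma gr_zeroE x : gr_coef gr_zero x = 0.
Proof. by rewrite /gr_coef fsfunE. Qed.

Lemma gr_deltaE g x : gr_coef (gr_delta g) x = (x == g)%:R.
Proof. by rewrite /gr_coef fsfunE in_fset1; case: eqP. Qed.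

Lemma gr_mulE a b x : gr_coef (gr_mul a b) x =
  \sum_(y <- finsupp a) gr_coef a y * gr_coef b (y^-1 * x)%g.
Proof.
rewrite {1}/gr_coef fsfunE; case: ifPn => // xn.
rewrite big_seq big1// => y ya.
rewrite (@gr_coef_notin b) ?mulr0//; apply: contra xn => yxb.
by apply/imfset2P; exists y => //; exists (y^-1 * x)%g => //; rewrite mulVKg.
Qed.

Lemma gr_sum_widen S a (F : Gamma -> int) : (finsupp a `<=` S)%fset ->
  \sum_(y <- finsupp a) gr_coef a y * F y = \sum_(y <- S) gr_coef a y * F y.
Proof.
move=> aS; apply: big_fset_incl => // y _ /gr_coef_notin ->.
by rewrite mul0r.
Qed.

Lemma gr_sum_shift y b S (F : Gamma -> int) :
  {subset [seq (y * z)%g | z <- finsupp b] <= S} ->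
  \sum_(w <- S) gr_coef b (y^-1 * w)%g * F w =
  \sum_(z <- finsupp b) gr_coef b z * F (y * z)%g.
Proof.
move=> bS.
rewrite (bigID (mem [seq (y * z)%g | z <- finsupp b])) /= addrC big1 ?add0r.
  rewrite -big_filter.
  rewrite (perm_big [seq (y * z)%g | z <- finsupp b]); last first.
    apply: uniq_perm.
    - by rewrite filter_uniq ?fset_uniq.
    - by rewrite map_inj_uniq ?fset_uniq//; exact: mulgI.
    - move=> w; rewrite mem_filter /=.
      by case: (boolP (w \in [seq _ | _ <- _])) => //= /bS.
  by rewrite big_map; apply: eq_bigr => z _; rewrite mulKg.
move=> w wn; rewrite gr_coef_notin ?mul0r//.
apply: contra wn => wb; apply/mapP; exists (y^-1 * w)%g => //.
by rewrite mulVKg.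
Qed.

Fact gr_addA : associative gr_add.
Proof. by move=> a b c; apply: gr_ext => x; rewrite !gr_addE addrA. Qed.

Fact gr_addC : commutative gr_add.
Proof. by move=> a b; apply: gr_ext => x; rewrite !gr_addE addrC. Qed.

Fact gr_add0 : left_id gr_zero gr_add.
Proof. by move=> a; apply: gr_ext => x; rewrite gr_addE gr_zeroE add0r. Qed.

Fact gr_addN : left_inverse gr_zero gr_opp gr_add.
Proof.
by move=> a; apply: gr_ext => x; rewrite gr_addE gr_zeroE gr_oppE addNr.
Qed.

HB.instance Definition _ :=
  GRing.isZmodule.Build ZG gr_addA gr_addC gr_add0 gr_addN.

Fact gr_mulDl : left_distributive gr_mul gr_add.
Proof.
move=> a b c; apply: gr_ext => x; rewrite gr_addE !gr_mulE.
set S := (finsupp a `|` finsupp b `|` finsupp (gr_add a b))%fset.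
rewrite !(@gr_sum_widen S) ?/S.
- rewrite -big_split/=; apply: eq_bigr => y _.
  by rewrite gr_addE mulrDl.
- by apply/fsubsetP => y yb; rewrite !in_fsetU yb orbT.
- by apply/fsubsetP => y yb; rewrite !in_fsetU yb.
- by apply/fsubsetP => y yb; rewrite !in_fsetU yb !orbT.
Qed.

Fact gr_mulDr : right_distributive gr_mul gr_add.
Proof.
move=> a b c; apply: gr_ext => x; rewrite gr_addE !gr_mulE -big_split/=.
by apply: eq_bigr => y _; rewrite gr_addE mulrDr.
Qed.

Lemma gr_delta_mulE g b x : gr_coef (gr_mul (gr_delta g) b) x =
  gr_coef b (g^-1 * x)%g.
Proof.
rewrite gr_mulE (@gr_sum_widen [fset g]%fset).
  by rewrite big_seq_fset1 gr_deltaE eqxx mul1r.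
apply/fsubsetP => y; apply: contraLR; rewrite in_fset1 => yg.
by rewrite memNfinsupp -/(gr_coef _ y) gr_deltaE (negbTE yg).
Qed.

Fact gr_mul1l : left_id (gr_delta 1%g) gr_mul.
Proof.
by move=> a; apply: gr_ext => x; rewrite gr_delta_mulE invg1 mul1g.
Qed.

Fact gr_mul1r : right_id (gr_delta 1%g) gr_mul.
Proof.
move=> a; apply: gr_ext => x; rewrite gr_mulE.
rewrite (@gr_sum_widen (x |` finsupp a)%fset) ?fsubsetU1//.
rewrite (big_fsetD1 x) ?fset1U1//= gr_deltaE mulVg eqxx mulr1.
rewrite big_seq big1 ?addr0// => y; rewrite in_fsetD1 => /andP[yx _].
rewrite gr_deltaE; case: eqP => [xy|]; last by rewrite mulr0.
by move: yx; rewrite -[x](mulVKg y) xy mulg1 eqxx.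
Qed.

Fact gr_mulA : associative gr_mul.
Proof.
move=> a b c; apply: gr_ext => x; rewrite !gr_mulE.
set S := [fset (y * z)%g | y in finsupp a, z in finsupp b]%fset.
have abS : (finsupp (gr_mul a b) `<=` S)%fset.
  by rewrite /gr_mul; exact: finsupp_sub.
rewrite (@gr_sum_widen S (gr_mul a b))//.
under [RHS]eq_bigr do rewrite gr_mulE mulr_suml.
rewrite exchange_big/= [LHS]big_seq [RHS]big_seq; apply: eq_bigr => y ya.
under [RHS]eq_bigr do rewrite -mulrA.
rewrite -mulr_sumr; congr (_ * _); rewrite gr_mulE.
rewrite (@gr_sum_shift y b S (fun w => gr_coef c (w^-1 * x)%g)).
  by apply: eq_bigr => z _; rewrite invgM mulgA.
by move=> _ /mapP[z zb ->]; apply/imfset2P; exists y => //; exists z.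
Qed.

Fact gr_1neq0 : gr_delta 1%g != gr_zero.
Proof.
apply/eqP => /(congr1 (fun a => gr_coef a 1%g)).
by rewrite gr_deltaE gr_zeroE eqxx.
Qed.

HB.instance Definition _ := GRing.Zmodule_isNzRing.Build ZG
  gr_mulA gr_mul1l gr_mul1r gr_mulDl gr_mulDr gr_1neq0.

Lemma gr_deltaM g h : gr_delta (g * h)%g = gr_delta g * gr_delta h.
Proof.
apply: gr_ext => x; rewrite gr_delta_mulE !gr_deltaE.
by rewrite -[in RHS](inj_eq (mulgI g)) mulVKg.
Qed.

End GroupRing.

Section CyclicModule.
Context {Gamma : groupType}.
Local Notation ZG := (group_ring Gamma).
Local Open Scope quotient_scope.
Implicit Types (f a b : ZG).

Definition left_ideal f : pred ZG := fun a => `[< exists b, a = b * f >].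

Fact left_ideal_zmod_closed f : zmod_closed (left_ideal f).
Proof.
split=> [|_ _ /asboolP[a ->] /asboolP[b ->]]; apply/asboolP.
  by exists 0; rewrite mul0r.
by exists (a - b); rewrite mulrBl.
Qed.

HB.instance Definition _ f :=
  GRing.isZmodClosed.Build ZG (left_ideal f) (left_ideal_zmod_closed f).

Definition left_ideal_zmod f : zmodClosed ZG :=
  GRing.ZmodClosed.clone ZG (left_ideal f) _.

(* The zmodule quotient ZGamma / (ZGamma f). The library notation
   [ideal_quot] only uses that its argument is an additive subgroup; the left
   module structure is added by [cyclic_scale] below. *)
Definition cyclic_module f : Type := {ideal_quot left_ideal_zmod f}.

HB.instance Definition _ f := GRing.Zmodule.on (cyclic_module f).

Definition cyclic_pi f (a : ZG) : cyclic_module f :=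
  \pi_{ideal_quot left_ideal_zmod f} a.

Definition cyclic_repr f (m : cyclic_module f) : ZG :=
  repr (m : {ideal_quot left_ideal_zmod f}).

Lemma cyclic_reprK f : cancel (@cyclic_repr f) (@cyclic_pi f).
Proof. by move=> m; exact: reprK. Qed.

Lemma cyclic_pi_eq f a b :
  cyclic_pi f a = cyclic_pi f b <-> exists c, a - b = c * f.
Proof.
split=> [/eqP|ab].
  by rewrite -Quotient.idealrBE => /asboolP.
by apply/eqP; rewrite -Quotient.idealrBE; apply/asboolP.
Qed.

Lemma cyclic_piD f : {morph cyclic_pi f : a b / a + b}.
Proof. by move=> a b; exact: Quotient.pi_add. Qed.

Definition cyclic_scale f a (m : cyclic_module f) : cyclic_module f :=
  cyclic_pi f (a * cyclic_repr m).

Lemma cyclic_scale_pi f a b :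
  cyclic_scale a (cyclic_pi f b) = cyclic_pi f (a * b).
Proof.
apply/cyclic_pi_eq.
have [c bc] := (cyclic_pi_eq f _ _).1 (cyclic_reprK (cyclic_pi f b)).
by exists (a * c); rewrite -mulrBr bc mulrA.
Qed.

Fact cyclic_scaleA f a b (m : cyclic_module f) :
  cyclic_scale a (cyclic_scale b m) = cyclic_scale (a * b) m.
Proof. by rewrite cyclic_scale_pi mulrA. Qed.

Fact cyclic_scale1 f : left_id 1 (@cyclic_scale f).
Proof. by move=> m; rewrite /cyclic_scale mul1r cyclic_reprK. Qed.

Fact cyclic_scaleDr f : right_distributive (@cyclic_scale f) +%R.
Proof.
move=> a m n; rewrite -(cyclic_reprK m) -(cyclic_reprK n) -cyclic_piD.
by rewrite !cyclic_scale_pi mulrDr cyclic_piD.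
Qed.

Fact cyclic_scaleDl f (m : cyclic_module f) :
  {morph (@cyclic_scale f)^~ m : a b / a + b}.
Proof. by move=> a b; rewrite /cyclic_scale mulrDl cyclic_piD. Qed.

HB.instance Definition _ f := GRing.Zmodule_isLmodule.Build ZG (cyclic_module f)
  (@cyclic_scaleA f) (@cyclic_scale1 f) (@cyclic_scaleDr f) (@cyclic_scaleDl f).

End CyclicModule.

Section Circle.
Variable R : realType.

Definition int_subgroup : pred R := fun x => x \is a Num.int.

Fact int_subgroup_zmod_closed : zmod_closed int_subgroup.
Proof.
by split=> [|x y xZ yZ]; rewrite /int_subgroup unfold_in ?rpred0 ?rpredB.
Qed.

HB.instance Definition _ :=
  GRing.isZmodClosed.Build R int_subgroup int_subgroup_zmod_closed.

Definition int_subgroup_zmod : zmodClosed R :=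
  GRing.ZmodClosed.clone R int_subgroup _.

(* R / Z with the quotient group structure and the quotient topology. *)
Definition circle : Type := quotient_topology {ideal_quot int_subgroup_zmod}.

HB.instance Definition _ := Topological.on circle.
HB.instance Definition _ := GRing.Zmodule.copy circle {ideal_quot int_subgroup_zmod}.

End Circle.

Section PontryaginDual.
Variable R : realType.

(* Pontryagin dual of [A] taken as a discrete group: every homomorphism
   A -> R/Z is continuous, and the topology is the compact-open one. *)
Definition discrete_dual (A : zmodType) : Type := {additive A -> circle R}.

Section Topology.
Variable A : zmodType.

HB.instance Definition _ := gen_eqMixin (discrete_dual A).
HB.instance Definition _ := gen_choiceMixin (discrete_dual A).

Definition discrete_dual_fun (chi : discrete_dual A) :
  {compact-open, discrete_topology A -> circle R} :=
  (chi : {additive A -> circle R}).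

HB.instance Definition _ := Topological.copy (discrete_dual A)
  (initial_topology discrete_dual_fun).
End Topology.

Section Action.
Context {Gamma : groupType} {M : lmodType (group_ring Gamma)}.
Implicit Types (g h : Gamma) (chi : discrete_dual M).

Definition dual_act_fun g chi (m : M) : circle R :=
  discrete_dual_fun chi (gr_delta g^-1%g *: m).

Fact dual_act_zmod_morphism g chi : zmod_morphism (dual_act_fun g chi).
Proof. by move=> m n; rewrite /dual_act_fun scalerBr; exact: raddfB. Qed.

HB.instance Definition _ g chi := GRing.isZmodMorphism.Build M (circle R)
  (dual_act_fun g chi) (dual_act_zmod_morphism g chi).

(* (g . chi)(m) = chi (g^-1 m); see [dual_actE]. *)
Definition dual_act g chi : discrete_dual M :=
  GRing.Additive.clone M (circle R) (dual_act_fun g chi) _.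

Lemma dual_actE g chi m :
  discrete_dual_fun (dual_act g chi) m =
  discrete_dual_fun chi (gr_delta g^-1%g *: m).
Proof. by []. Qed.

End Action.

Lemma discrete_dual_ext (A : zmodType) (chi psi : discrete_dual A) :
  discrete_dual_fun chi =1 discrete_dual_fun psi -> chi = psi.
Proof.
move: chi psi => [f [[[f1 f2]]]] [g [[[g1 g2]]]] /funext/= fg.
rewrite /discrete_dual_fun/= in fg; subst g.
by rewrite (Prop_irrelevance f1 g1) (Prop_irrelevance f2 g2).
Qed.

Section ActionTheory.
Context {Gamma : groupType} {M : lmodType (group_ring Gamma)}.
Implicit Types (g h : Gamma) (chi : discrete_dual M).

Lemma dual_act1 chi : dual_act 1%g chi = chi.
Proof.
apply: discrete_dual_ext => m; rewrite dual_actE invg1.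
by rewrite (_ : gr_delta _ = 1)// scale1r.
Qed.

Lemma dual_actM g h chi : dual_act (g * h)%g chi = dual_act g (dual_act h chi).
Proof.
apply: discrete_dual_ext => m; rewrite !dual_actE invgM gr_deltaM.
by rewrite scalerA.
Qed.

Lemma dual_act_continuous g : continuous (dual_act g : discrete_dual M -> _).
Proof.
apply: continuous_comp_initial => chi.
have Fchi := @fmap_filter _ _ (@discrete_dual_fun M \o dual_act g) _
  (nbhs_filter chi).
apply/(@compact_open_cvgP _ _ _ _ Fchi) => K O cK oO gKO.
pose gK : set (discrete_topology M) := [set gr_delta g^-1%g *: m | m in K].
have cgK : compact gK.
  apply: continuous_compact => //; apply: continuous_subspaceT.
  by apply/continuousP => U _; exact: discrete_open.
have : nbhs (discrete_dual_fun chi) [set psi | psi @` gK `<=` O].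
  apply: open_nbhs_nbhs; split; first exact: compact_open_open.
  by move=> _ [_ [m Km <-] <-]; apply: gKO; exists m.
move=> /initial_continuous; apply: (@filterS _ _ (nbhs_filter chi)).
move=> psi psiO _ [m Km <-].
by apply: psiO; exists (gr_delta g^-1%g *: m) => //; exists m.
Qed.

End ActionTheory.

End PontryaginDual.

Definition principal_space (R : realType) (Gamma : groupType)
  (f : group_ring Gamma) : topologicalType := discrete_dual R (cyclic_module f).

Definition principal_action (R : realType) (Gamma : groupType)
    (f : group_ring Gamma) (g : Gamma) :
    principal_space R f -> principal_space R f :=
  @dual_act R Gamma (cyclic_module f) g.

Record compatible_metric {R : realType} {X : topologicalType}
    (d : X -> X -> R) : Prop := {
  metric_eq0 : forall x y, d x y = 0 <-> x = y ;
  metric_symm : forall x y, d x y = d y x ;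
  metric_trian : forall x y z, d x z <= d x y + d y z ;
  metric_nbhsP : forall (x : X) (A : set X),
    nbhs x A <-> exists2 e : R, 0 < e & [set y | d x y < e] `<=` A
}.

Section Dynamics.
Context {R : realType} {Gamma : groupType} {X : Type}.
Variables (d : X -> X -> R) (alpha : Gamma -> X -> X).

Definition expansive : Prop :=
  exists2 c : R, 0 < c &
    forall x y : X, x <> y -> exists g : Gamma, c < d (alpha g x) (alpha g y).

Definition pseudo_orbit (S : set Gamma) (delta : R) (x_ : Gamma -> X) : Prop :=
  forall s, S s -> forall g, d (alpha s (x_ g)) (x_ (s * g)%g) < delta.

Definition traced (eps : R) (x_ : Gamma -> X) (x : X) : Prop :=
  forall g, d (alpha g x) (x_ g) < eps.

Definition pseudo_orbit_tracing : Prop :=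
  forall eps : R, 0 < eps ->
    exists delta : R, exists S : set Gamma,
      [/\ 0 < delta, finite_set S &
          forall x_ : Gamma -> X, pseudo_orbit S delta x_ ->
            exists x : X, traced eps x_ x].

End Dynamics.

(* Main.v *)
From HB Require Import structures.
Require Import Defs.
From mathcomp Require Import all_boot all_order all_algebra.
From mathcomp Require Import finmap generic_quotient ring lra.
From mathcomp Require Import all_classical all_reals topology normedtype.

(** Why every expansive principal action has the tracing property.

    A point [x] of the dual of ZGamma / ZGamma f is determined by its
    coordinates [x_h] in R/Z, the values at the group elements; the families
    that occur are exactly those with [sum_k f_k x_(h k) = 0] for all [h].  For
    a real family [v] put [(T v)_h = sum_k f_k v_(h k)] (this is [conv f v]).
    So a real family [t] represents a point if and only if [T t] is integral
    ([char_of]), and the action translates the coordinates.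

    A pseudo-orbit [x_g] suggests the family [t_h = (x_(h^-1))_1].  Since it is
    nearly an orbit, [t_(h k)] is close modulo Z to [(x_(h^-1))_k] for the
    finitely many [k] in the support of [f], so [T t] is uniformly close to an
    integral family.  If the small error [e] can be written [e = T z] with [z]
    uniformly small, then [t - z] represents a point, and this point traces the
    pseudo-orbit.  What is needed is thus that [T] is onto on bounded real
    families, with a bound on the solution ([conv_surj]).

    Expansiveness gives injectivity of [T] on bounded families
    ([expansive_conv_inj]): a bounded kernel vector, scaled down, is a non-zero
    point all of whose translates stay close to zero.  Passing from injectivity
    to surjectivity is a direct finiteness phenomenon, and is proved as follows.

    - Bounded families with the topology of pointwise convergence are compact.
      Hence a linear system [T z = e] that has approximate solutions with a
      uniform bound has an exact one ([bounded_solution]), and injectivity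
      improves to a lower bound [|v| <= C |T v|] in the sup norm
      ([conv_bounded_below]).

    - In the group ring with its trace and involution, put [L = M - f^* f] and
      [L' = M - f f^*] with [M] an upper bound for the square of the l2 operator
      norm of [f^*].  The l2 norms of the powers of [L / M] decrease, and what
      they lose controls the l2 norm of [f (L / M)^n], so [f (L / M)^n] becomes
      small; by injectivity [(L / M)^n] itself becomes small at the identity,
      and this value, for [2 n] in place of [n], is the squared l2 norm of
      [(L / M)^n] ([gap_decay]).  As [f^* f] and [f f^*] have the same moments
      for the trace, [(L' / M)^n] is also small in l2.  But [M^n - L'^n] is of
      the form [f a], so [f] has right inverses up to an error that is small in
      l2, hence in the sup norm ([approx_right_inverse]).

    - These right inverses solve [T u = e] up to a small error for finitely
      supported [e]; the lower bound controls the sup norm of [u] independently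
      of the support, and compactness yields the general case.

    The metric on the compact dual enters only through the equivalence of its
    uniformity with that of coordinatewise convergence ([metric_near_zero],
    [close_metric]). *)

Set Implicit Arguments.
Unset Strict Implicit.
Unset Printing Implicit Defensive.

Import Order.TTheory GRing.Theory Num.Theory.
Import numFieldTopology.Exports numFieldNormedType.Exports.

Local Open Scope classical_set_scope.
Local Open Scope ring_scope.

(** * Trace, involution and l2 norm on the integral group ring *)

Section GroupRingTheory.
Context {Gamma : groupType}.
Local Notation ZG := (group_ring Gamma).
Implicit Types (a b x y f : ZG) (g h k : Gamma).

(** The coefficient with its arguments swapped, so that it is a morphism. *)
Definition gr_coef_at k a : int := gr_coef a k.

Fact gr_coef_at_zmod_morphism k : zmod_morphism (gr_coef_at k).
Proof. by move=> a b; rewrite /gr_coef_at gr_addE gr_oppE. Qed.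

HB.instance Definition _ k := GRing.isZmodMorphism.Build ZG int
  (gr_coef_at k) (gr_coef_at_zmod_morphism k).

Lemma gr_coefB a b k : gr_coef (a - b) k = gr_coef a k - gr_coef b k.
Proof. exact: gr_coef_at_zmod_morphism. Qed.

Lemma gr_expand a : a = \sum_(k <- finsupp a) gr_delta k *~ gr_coef a k.
Proof.
apply: gr_ext => h; rewrite -[RHS]/(gr_coef_at h _) raddf_sum /=.
under eq_bigr do rewrite raddfMz /= /gr_coef_at gr_deltaE.
case: (boolP (h \in finsupp a)) => [ha|ha].
  rewrite (big_fsetD1 h) //= eqxx intz big1_seq ?addr0 // => k.
  by rewrite /= in_fsetD1 eq_sym => /andP[/negPf-> _]; rewrite mul0rz.
rewrite gr_coef_notin // big1_seq // => k /= ka.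
by case: eqP => [hk|]; [rewrite hk ka in ha|rewrite mul0rz].
Qed.

(** Every element is an integral combination of group elements, and stability
    under subtraction gives that under integral combinations. *)
Lemma gr_ind (P : ZG -> Prop) : (forall a b, P a -> P b -> P (a - b)) ->
  (forall g, P (gr_delta g)) -> forall a, P a.
Proof.
move=> PB Pd.
have P0 : P 0 by rewrite -(subrr (gr_delta 1%g)); exact: PB.
have PN a : P a -> P (- a) by move=> Pa; rewrite -[- a]add0r; exact: PB.
have PD a b : P a -> P b -> P (a + b).
  by move=> Pa Pb; rewrite -[b]opprK; apply: PB => //; exact: PN.
have PM a n : P a -> P (a *+ n).
  by move=> Pa; elim: n => [|n IH]; rewrite ?mulr0n // mulrS; exact: PD.
move=> a; rewrite (gr_expand a); elim/big_ind: _ => // k _.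
by case: (gr_coef a k) => n; [|apply: PN]; exact: PM.
Qed.

Definition gr_tr : ZG -> int := gr_coef_at 1%g.

HB.instance Definition _ := GRing.Additive.copy gr_tr (gr_coef_at 1%g).

Definition gr_star a : ZG :=
  [fsfun k in [fset h^-1%g | h in finsupp a]%fset => gr_coef a k^-1%g].

Lemma gr_starE a k : gr_coef (gr_star a) k = gr_coef a k^-1%g.
Proof.
rewrite {1}/gr_coef fsfunE; case: ifPn => // kn.
rewrite gr_coef_notin //; apply: contra kn => ka.
by apply/imfsetP; exists k^-1%g => //=; rewrite invgK.
Qed.

Lemma gr_starK : involutive gr_star.
Proof. by move=> a; apply: gr_ext => k; rewrite !gr_starE invgK. Qed.

Lemma gr_starB a b : gr_star (a - b) = gr_star a - gr_star b.
Proof. by apply: gr_ext => k; rewrite !(gr_starE, gr_coefB). Qed.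

HB.instance Definition _ := GRing.isZmodMorphism.Build ZG ZG gr_star gr_starB.

Lemma gr_star_delta g : gr_star (gr_delta g) = gr_delta g^-1%g.
Proof.
by apply: gr_ext => k; rewrite gr_starE !gr_deltaE eqg_invLR.
Qed.

Lemma gr_mul_deltaE a g k : gr_coef (a * gr_delta g) k = gr_coef a (k * g^-1)%g.
Proof.
elim/gr_ind: a => [a b IHa IHb|h]; first by rewrite mulrBl !gr_coefB IHa IHb.
by rewrite -gr_deltaM !gr_deltaE -[in RHS](inj_eq (mulIg g)) mulgVK.
Qed.

Lemma gr_starM a b : gr_star (a * b) = gr_star b * gr_star a.
Proof.
elim/gr_ind: a => [a a' IH IH'|g].
  by rewrite mulrBl !gr_starB mulrBr IH IH'.
apply: gr_ext => k; rewrite gr_starE gr_delta_mulE gr_star_delta gr_mul_deltaE.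
by rewrite gr_starE !invgM !invgK.
Qed.

(** Both sides are biadditive, and a group element may be moved around by
    conjugation invariance of the coefficient at the identity. *)
Lemma gr_trC a b : gr_tr (a * b) = gr_tr (b * a).
Proof.
elim/gr_ind: a => [a a' IH IH'|g].
  by rewrite mulrBl mulrBr !raddfB /= IH IH'.
by rewrite /gr_tr /gr_coef_at gr_delta_mulE gr_mul_deltaE mulg1 mul1g.
Qed.

Lemma gr_tr_star a : gr_tr (gr_star a) = gr_tr a.
Proof. by rewrite /gr_tr /gr_coef_at gr_starE invg1. Qed.

(** The squared l2 norm of the coefficient family. *)
Definition normsq a : int := gr_tr (gr_star a * a).

Lemma sqr_coef_le_normsq a k : gr_coef a k ^+ 2 <= normsq a.
Proof.
have -> : normsq a = \sum_(h <- finsupp (gr_star a)) gr_coef (gr_star a) h ^+ 2.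
  rewrite /normsq /gr_tr /gr_coef_at gr_mulE; apply: eq_bigr => h _.
  by rewrite mulg1 -gr_starE.
case: (boolP (k^-1%g \in finsupp (gr_star a))) => ka.
  rewrite (big_fsetD1 k^-1%g) //= gr_starE invgK lerDl.
  by apply: sumr_ge0 => h _; exact: sqr_ge0.
have -> : gr_coef a k = 0 by rewrite -[k]invgK -gr_starE gr_coef_notin.
by rewrite expr0n /=; apply: sumr_ge0 => h _; exact: sqr_ge0.
Qed.

Lemma normsq_ge0 a : 0 <= normsq a.
Proof. by apply: le_trans (sqr_coef_le_normsq a 1%g); exact: sqr_ge0. Qed.

Lemma normsq_delta g a : normsq (gr_delta g * a) = normsq a.
Proof.
rewrite /normsq gr_starM gr_star_delta -mulrA; congr (gr_tr (_ * _)).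
apply: gr_ext => k; rewrite !gr_delta_mulE; congr gr_coef.
by rewrite invgK mulKg.
Qed.

Lemma normsqB a b :
  normsq (a - b) = normsq a - 2 * gr_tr (gr_star a * b) + normsq b.
Proof.
rewrite /normsq gr_starB mulrBl !mulrBr !raddfB /=.
(* The two cross terms are exchanged by the involution. *)
have <- : gr_tr (gr_star a * b) = gr_tr (gr_star b * a).
  by rewrite -gr_tr_star gr_starM gr_starK.
by ring.
Qed.

(** The parallelogram inequality: the other half of the identity is
    [normsq (a + b) >= 0]. *)
Lemma normsqB_le a b : normsq (a - b) <= 2 * normsq a + 2 * normsq b.
Proof.
have : 0 <= normsq (a - - b) by exact: normsq_ge0.
have normsqN : normsq (- b) = normsq b by rewrite /normsq raddfN mulrNN.
by rewrite !normsqB normsqN mulrN raddfN /=; lra.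
Qed.

(** Multiplication by a group element is isometric, and boundedness is stable
    under subtraction. *)
Lemma normsqM_bounded a :
  exists2 M : int, 1 <= M & forall x, normsq (a * x) <= M * normsq x.
Proof.
elim/gr_ind: a => [a b [M M1 aM] [N N1 bN]|g]; last first.
  by exists 1 => // x; rewrite normsq_delta mul1r.
exists (2 * (M + N)); first by lra.
move=> x; rewrite mulrBl; apply: le_trans (normsqB_le _ _) _.
by have := aM x; have := bN x; lra.
Qed.

End GroupRingTheory.

Section PowerIteration.
Context {Gamma : groupType}.
Local Notation ZG := (group_ring Gamma).
Variables (f : ZG) (M : int).
Implicit Types (a b x y : ZG).
Hypothesis fM : forall x, normsq (gr_star f * x) <= M * normsq x.

(** The powers of [gapL / M] and [gapR / M] approximate the projections onto the
    kernels of left multiplication by [f] and by its adjoint, respectively. *)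
Definition gapL : ZG := M%:~R - gr_star f * f.
Definition gapR : ZG := M%:~R - f * gr_star f.

Lemma gr_star_int (n : int) : gr_star (n%:~R : ZG) = n%:~R.
Proof. by rewrite raddfMz /= (gr_star_delta 1%g) invg1. Qed.

Lemma gr_starX a n : gr_star (a ^+ n) = gr_star a ^+ n.
Proof.
elim: n => [|n IH]; first exact: (gr_star_int 1).
by rewrite exprS gr_starM IH exprSr.
Qed.

(** Expand the square and use [|f^* (f x)|^2 <= M |f x|^2]. *)
Lemma normsq_gapL x :
  normsq (gapL * x) <= M ^+ 2 * normsq x - M * normsq (f * x).
Proof.
rewrite /gapL mulrBl mulrzl normsqB.
have -> : normsq (x *~ M) = M ^+ 2 * normsq x.
  by rewrite /normsq raddfMz /= mulrzAl mulrzAr !raddfMz /= !mulrzz; ring.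
have -> : gr_tr (gr_star (x *~ M) * (gr_star f * f * x)) = M * normsq (f * x).
  by rewrite raddfMz /= mulrzAl raddfMz /= mulrzz mulrC /normsq gr_starM !mulrA.
have := fM (f * x); rewrite mulrA; lra.
Qed.

Lemma gap_intertwine n : gapR ^+ n * f = f * gapL ^+ n.
Proof.
elim: n => [|n IH]; first by rewrite !expr0 mul1r mulr1.
rewrite exprSr -mulrA [gapR * f](_ : _ = f * gapL); last first.
  rewrite /gapR /gapL mulrBl mulrBr mulrA.
  by rewrite commr_int.
by rewrite mulrA IH exprSr mulrA.
Qed.

(** [f^* f] and [f f^*] have the same moments: cyclicity of the trace moves the
    leading factor [f] to the end, where it is absorbed by intertwining. *)
Lemma gap_trace n : gr_tr (gapR ^+ n) = gr_tr (gapL ^+ n).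
Proof.
elim: n => [|n IH] //; rewrite !exprS {1}/gapR {1}/gapL !mulrBl !raddfB /=.
congr (_ - _); first by rewrite !mulrzl !raddfMz /= IH.
by rewrite -mulrA gr_trC -mulrA gap_intertwine mulrA.
Qed.

(** [M^n - (M - y)^n] is divisible by [y = f f^*], hence on the left by [f]. *)
Lemma gapR_range n : exists a, f * a = (M ^+ n)%:~R - gapR ^+ n.
Proof.
elim: n => [|n [a fa]]; first by exists 0; rewrite mulr0 !expr0 subrr.
exists (M%:~R * a + gr_star f * gapR ^+ n).
rewrite mulrDr (mulrA f M%:~R) (commr_int f M) -mulrA fa mulrA.
rewrite exprS [in RHS]exprS {3}/gapR intrM mulrBr mulrBl.
by rewrite opprB addrA addrAC.
Qed.

Lemma gapL_star : gr_star gapL = gapL.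
Proof. by rewrite /gapL raddfB /= gr_star_int gr_starM gr_starK. Qed.

Lemma gapR_star : gr_star gapR = gapR.
Proof. by rewrite /gapR raddfB /= gr_star_int gr_starM gr_starK. Qed.

(** Both are traces of even powers, since [gapL] and [gapR] are self-adjoint. *)
Lemma normsq_gapR n : normsq (gapR ^+ n) = normsq (gapL ^+ n).
Proof.
by rewrite /normsq !gr_starX gapL_star gapR_star -!exprD gap_trace.
Qed.

End PowerIteration.

(** * Convolution of real families by group ring elements *)

Section Convolution.
Context {R : realType} {Gamma : groupType}.
Local Notation ZG := (group_ring Gamma).
Implicit Types (a b f : ZG) (u v : Gamma -> R) (g h k : Gamma).

(** The additive extension of [v] to the group ring. *)
Definition ev v a : R := \sum_(k <- finsupp a) (gr_coef a k)%:~R * v k.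

Lemma ev_widen (S : {fset Gamma}) v a : (finsupp a `<=` S)%fset ->
  ev v a = \sum_(k <- S) (gr_coef a k)%:~R * v k.
Proof.
move=> aS; apply: big_fset_incl => // y _ /gr_coef_notin ->.
by rewrite mul0r.
Qed.

Fact ev_zmod_morphism v : zmod_morphism (ev v).
Proof.
move=> a b; set S := (finsupp a `|` finsupp b `|` finsupp (a - b)%R)%fset.
rewrite !(@ev_widen S) ?/S.
- rewrite -sumrB; apply: eq_bigr => y _.
  by rewrite gr_coefB intrB mulrBl.
- by apply/fsubsetP => y yb; rewrite !in_fsetU yb orbT.
- by apply/fsubsetP => y yb; rewrite !in_fsetU yb.
- by apply/fsubsetP => y yb; rewrite !in_fsetU yb !orbT.
Qed.

HB.instance Definition _ v :=
  GRing.isZmodMorphism.Build ZG R (ev v) (ev_zmod_morphism v).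

Lemma ev_delta v g : ev v (gr_delta g) = v g.
Proof.
rewrite (@ev_widen [fset g]%fset).
  by rewrite big_seq_fset1 gr_deltaE eqxx mul1r.
apply/fsubsetP => y; apply: contraLR; rewrite in_fset1 => yg.
by rewrite memNfinsupp -/(gr_coef _ y) gr_deltaE (negbTE yg).
Qed.

Lemma evBv u v a : ev (fun k => u k - v k) a = ev u a - ev v a.
Proof. by rewrite /ev -sumrB; apply: eq_bigr => k _; rewrite mulrBr. Qed.

Lemma evZv c v a : ev (fun k => c * v k) a = c * ev v a.
Proof. by rewrite /ev mulr_sumr; apply: eq_bigr => k _; rewrite mulrCA. Qed.

Lemma ev_sumv (I : Type) (r : seq I) (F : I -> Gamma -> R) a :
  ev (fun k => \sum_(i <- r) F i k) a = \sum_(i <- r) ev (F i) a.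
Proof.
rewrite /ev exchange_big /=; apply: eq_bigr => k _.
by rewrite mulr_sumr.
Qed.

(** The value at [h] pairs [a] with the translate of [v] by [h]; it is the value
    of [v] at the ring element [h a] ([ev_mul_delta]). *)
Definition conv a v h : R := ev (fun k => v (h * k)%g) a.

Lemma ev_mul_delta v g a : ev v (gr_delta g * a) = conv a v g.
Proof.
move: a; apply: gr_ind => [a b IHa IHb|h].
  by rewrite mulrBr /conv !raddfB /= IHa IHb.
by rewrite -gr_deltaM /conv !ev_delta.
Qed.

Lemma conv_shift a v g h : conv a (fun k => v (g * k)%g) h = conv a v (g * h)%g.
Proof. by rewrite /conv; congr ev; apply/funext => k /=; rewrite mulgA. Qed.

(** After inversion of the index, [conv a] is left multiplication by [a] in the
    group ring; so ring identities produce solutions of [conv a u = e]. *)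
Lemma conv_coef a b g h : conv a (fun k => (gr_coef b (k^-1 * g)%g)%:~R) h =
  (gr_coef (a * b) (h^-1 * g)%g)%:~R.
Proof.
rewrite gr_mulE rmorph_sum /=; apply: eq_bigr => k _.
by rewrite intrM invgM mulgA.
Qed.

Lemma ev_bounded a : exists2 C : R, 0 < C & forall v S, 0 <= S ->
  (forall k, k \in finsupp a -> `|v k| <= S) -> `|ev v a| <= C * S.
Proof.
exists (\sum_(k <- finsupp a) `|(gr_coef a k)%:~R| + 1).
  by apply: ltr_pwDr => //; exact: sumr_ge0.
move=> v S S0 vS.
apply: (@le_trans _ _ (\sum_(k <- finsupp a) `|(gr_coef a k)%:~R| * S)).
  rewrite /ev; apply: le_trans (ler_norm_sum _ _ _) _.
  rewrite big_seq [leRHS]big_seq.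
  by apply: ler_sum => k ka; rewrite normrM ler_wpM2l // vS.
by rewrite -mulr_suml ler_wpM2r // lerDl.
Qed.

Lemma ev_cvg (T : Type) (F : set_system T) (w : T -> Gamma -> R) v a :
  Filter F -> (forall k, w^~ k @ F --> v k) ->
  (fun x => ev (w x) a) @ F --> ev v a.
Proof.
move=> FF wv; move: a; apply: gr_ind => [a b IHa IHb|g].
  under eq_fun do rewrite raddfB.
  by rewrite raddfB; apply: cvgB.
under eq_fun do rewrite ev_delta.
by rewrite ev_delta; exact: wv.
Qed.

(** Compactness of bounded families, used one coordinate at a time. *)
Lemma ultra_bounded_cvg (T : Type) (U : set_system T) (g : T -> R) (B : R) :
  UltraFilter U -> U [set x | `|g x| <= B] ->
  exists2 l, `|l| <= B & g @ U --> l.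
Proof.
move=> UU gB; have UP : ProperFilter U by exact: ultra_proper.
have gUB : U (g @^-1` [set` `[(- B), B]]).
  by apply: filterS gB => x gx; rewrite /= in_itv /= -ler_norml.
have [l [/= lB lU]] :=
  @segment_compact R (- B) B _ (fmap_proper_filter g UP) gUB.
exists l; first by move: lB; rewrite in_itv /= -ler_norml.
move=> N Nl; have [//|UN] := in_ultra_setVsetC (g @^-1` N) UU.
by have [x []] := lU (~` N) N UN Nl.
Qed.

(** Take a limit of the approximate solutions along an ultrafilter: every
    coordinate of [conv f v] involves finitely many coordinates of [v], so all
    conditions pass to the limit.  The lower bound [eps] at the identity serves
    to produce non-zero kernel vectors. *)
Lemma bounded_solution f (B eps : R) (e : Gamma -> R) :
  (forall (F : {fset Gamma}) (delta : R), 0 < delta -> exists v,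
    [/\ forall h, `|v h| <= B, eps <= `|v 1%g| &
        forall h, h \in F -> `|conv f v h - e h| <= delta]) ->
  exists v, [/\ forall h, `|v h| <= B, eps <= `|v 1%g| &
    forall h, conv f v h = e h].
Proof.
move=> approx.
pose A (p : {fset Gamma} * R) := [set v : Gamma -> R |
  [/\ forall h, `|v h| <= B, eps <= `|v 1%g| &
      forall h, h \in p.1 -> `|conv f v h - e h| <= p.2]].
pose G := filter_from [set p : {fset Gamma} * R | 0 < p.2] A.
have GF : ProperFilter G.
  apply: filter_from_proper => [|[F d] /= d0]; last first.
    by have [v vP] := approx F d d0; exists v.
  apply: filter_from_filter; first by exists (fset0, 1) => /=.
  move=> [F d] [F' d'] /= d0 d'0; exists ((F `|` F')%fset, Num.min d d') => /=.
    by rewrite lt_min d0 d'0.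
  move=> v [/= vB ve vF]; split; split=> // h hF.
    apply: le_trans (vF h _) _; first by rewrite in_fsetU hF.
    by rewrite ge_min lexx.
  apply: le_trans (vF h _) _; first by rewrite in_fsetU hF orbT.
  by rewrite ge_min lexx orbT.
have [U [UU GU]] := ultraFilterLemma GF.
have UP : ProperFilter U by exact: ultra_proper.
have UA F d : 0 < d -> U (A (F, d)).
  by move=> d0; apply: GU; exists (F, d).
have /choice[v vP] : forall h, exists l, `|l| <= B /\ (fun u => u h) @ U --> l.
  move=> h; have [|l lB Ul] := @ultra_bounded_cvg _ U (fun u => u h) B UU.
    by apply: filterS (UA fset0 1 ltr01) => u [uB _ _]; exact: uB.
  by exists l.
exists v; split=> [h||h]; first exact: (vP h).1.
  have : (fun u => `|u 1%g|) @ U --> `|v 1%g|.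
    by apply: cvg_norm; exact: (vP 1%g).2.
  by move=> /cvgr_to_ge; apply; apply: filterS (UA fset0 1 ltr01) => u [].
have cv : (fun u => conv f u h) @ U --> conv f v h.
  by apply: ev_cvg => k; exact: (vP _).2.
apply/eqP; rewrite -subr_eq0 -normr_le0; apply/ler_addgt0Pl => d d0.
rewrite addr0.
have : (fun u => `|conv f u h - e h|) @ U --> `|conv f v h - e h|.
  by apply: cvg_norm; apply: cvgB => //; exact: cvg_cst.
move=> /cvgr_to_le; apply; apply: filterS (UA [fset h]%fset d d0) => u [_ _].
by apply; rewrite in_fset1.
Qed.

End Convolution.

(** * From injectivity to surjectivity on bounded families *)

Section BoundedInverse.
Context {R : realType} {Gamma : groupType}.
Local Notation ZG := (group_ring Gamma).
Implicit Types (a b : ZG) (u v : Gamma -> R) (g h k : Gamma).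
Variable f : ZG.
Hypothesis conv_inj : forall v B, (forall h, `|v h| <= B) ->
  (forall h, conv f v h = 0) -> forall h, v h = 0.

(** Otherwise a limit of counterexamples would be a bounded kernel vector that
    does not vanish at the identity. *)
Lemma conv_small (eps : R) : 0 < eps -> exists2 delta : R, 0 < delta &
  forall v, (forall h, `|v h| <= 1) -> (forall h, `|conv f v h| <= delta) ->
  `|v 1%g| <= eps.
Proof.
move=> eps0; apply: contrapT => nodelta.
have [|v [vB ve v0]] := @bounded_solution R Gamma f 1 eps (fun=> 0).
  move=> F delta d0; apply: contrapT => nov; apply: nodelta.
  exists delta => // v v1 vd; rewrite leNgt; apply/negP => ve; apply: nov.
  by exists v; split=> [//||h _]; [exact: ltW|rewrite subr0].
by move: ve; rewrite (conv_inj vB v0) normr0 leNgt eps0.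
Qed.

(** Apply the preceding lemma to the translates of [v], scaled to sup norm 1: if
    [|v| > B / delta], then all values of [v] are at most half its sup norm. *)
Lemma conv_bounded_below : exists2 C : R, 0 < C & forall v S B, 0 < B ->
  (forall h, `|v h| <= S) -> (forall h, `|conv f v h| <= B) ->
  forall h, `|v h| <= C * B.
Proof.
have h0 : 0 < 2^-1 :> R by rewrite invr_gt0.
have [delta d0 small] := conv_small h0.
exists delta^-1; first by rewrite invr_gt0.
move=> v S B B0 vS vB h.
pose s := sup (range (fun h => `|v h|)).
have sup_v : has_sup (range (fun h => `|v h|)).
  by split; [exists `|v h|, h|exists S => _ [k _ <-]].
have vs k : `|v k| <= s by apply: ub_le_sup; [exact: sup_v.2|exists k].
apply: le_trans (vs h) _; rewrite leNgt; apply/negP => Bs.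
have s0 : 0 < s by apply: le_lt_trans Bs; rewrite mulr_ge0 ?invr_ge0 ?ltW.
suff : s <= s / 2 by rewrite leNgt ltr_pdivrMr // ltr_pMr // ltr1n.
apply: ge_sup; first by case: sup_v.
move=> _ [k _ <-].
have sN x : `|s^-1 * x| = s^-1 * `|x| by rewrite normrM gtr0_norm ?invr_gt0.
have := small (fun g => s^-1 * v (k * g)%g); rewrite mulg1 sN.
rewrite ler_pdivrMl //; apply.
  by move=> g; rewrite sN ler_pdivrMl // mulr1.
move=> g; rewrite {1}/conv evZv -/(conv f (fun g => v (k * g)%g) g) conv_shift.
rewrite sN ler_pdivrMl //.
by apply: le_trans (vB _) _; rewrite mulrC -ler_pdivrMl // ltW.
Qed.

Section Decay.
Variable M : int.
Hypothesis M1 : 1 <= M.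
Hypothesis fM : forall x, normsq (gr_star f * x) <= M * normsq x.

Let L := gapL f M.
Let MR : R := M%:~R.

Let MR1 : 1 <= MR. Proof. by rewrite ler1z. Qed.

(** The squared l2 norm of [(L / M)^n]. *)
Definition gap_mass n : R := (normsq (L ^+ n))%:~R / MR ^+ n.*2.

Lemma gap_mass_ge0 n : 0 <= gap_mass n.
Proof.
by rewrite divr_ge0 ?ler0z ?normsq_ge0 ?exprn_ge0 // (le_trans ler01 MR1).
Qed.

Lemma gap_mass_step n :
  gap_mass n.+1 <= gap_mass n - (normsq (f * L ^+ n))%:~R / MR ^+ n.*2.+1.
Proof.
have MR0 : 0 < MR by exact: lt_le_trans MR1.
rewrite /gap_mass exprS doubleS.
rewrite ler_pdivrMr ?exprn_gt0 //.
have := normsq_gapL fM (L ^+ n); rewrite -/L -(ler_int R) => /le_trans; apply.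
rewrite intrB !intrM -/MR le_eqVlt; apply/orP; left; apply/eqP.
rewrite !exprS; field.
by rewrite expf_neq0 ?gt_eqF.
Qed.

Lemma gap_mass_antitone n : gap_mass n.+1 <= gap_mass n.
Proof.
apply: le_trans (gap_mass_step n) _; rewrite gerBl divr_ge0 ?ler0z ?normsq_ge0 //.
by rewrite exprn_ge0 // (le_trans ler01 MR1).
Qed.

Lemma gap_mass_le1 n : gap_mass n <= 1.
Proof.
elim: n => [|n IH]; last by apply: le_trans IH; exact: gap_mass_antitone.
rewrite /gap_mass !expr0 divr1 /normsq mulr1.
by rewrite (gr_star_delta 1%g) invg1 /gr_tr /gr_coef_at gr_deltaE eqxx.
Qed.

(** The masses decrease and are nonnegative, so the residuals, which bound the
    decrements from below, cannot all stay large.  Only even exponents are of use in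
    [gap_decay]. *)
Lemma residual_small (delta : R) : 0 < delta ->
  exists n, (normsq (f * L ^+ n.*2))%:~R <= delta * MR ^+ n.*2.*2.
Proof.
move=> d0; apply: contrapT => /forallNP big.
have MR0 : 0 < MR by exact: lt_le_trans MR1.
have down n : gap_mass n.*2 <= 1 - (delta / MR) *+ n.
  elim: n => [|n IH]; first by rewrite mulr0n subr0 gap_mass_le1.
  rewrite doubleS; apply: le_trans (gap_mass_antitone _) _.
  apply: le_trans (gap_mass_step _) _; rewrite mulrSr opprD addrA lerB //.
  rewrite exprSr invfM mulrA ler_pM2r ?invr_gt0 //.
  rewrite ler_pdivlMr ?exprn_gt0 //.
  by have /negP := big n; rewrite -ltNge => /ltW.
have [n nbig] : exists n, MR / delta < n%:R.
  by exists (Num.bound (MR / delta)); rewrite archi_boundP // divr_ge0 ?ltW.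
have := le_trans (gap_mass_ge0 n.*2) (down n); rewrite subr_ge0 -mulr_natr leNgt.
by rewrite mulrAC ltr_pdivlMr // mul1r mulrC -ltr_pdivrMr // nbig.
Qed.

(** The family [(L / M)^(2 n)] is bounded by 1 and its image under [conv f] is
    small, so its value at the identity is small; that value is the squared l2
    norm of [(L / M)^n]. *)
Lemma gap_decay (eps : R) : 0 < eps ->
  exists n, (normsq (L ^+ n))%:~R <= eps * MR ^+ n.*2.
Proof.
move=> e0; have [delta d0 small] := conv_small e0.
have MR0 : 0 < MR by exact: lt_le_trans MR1.
have [n fn] := residual_small (exprn_gt0 2 d0); exists n.
have normE a k (c : R) : 0 <= c -> (normsq a)%:~R <= c ^+ 2 ->
    `|(gr_coef a k)%:~R| <= c.
  move=> c0 ac; rewrite -(@ler_pXn2r _ 2) ?nnegrE // real_normK ?num_real //.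
  by apply: le_trans ac; rewrite -rmorphXn ler_int sqr_coef_le_normsq.
pose c := MR ^+ n.*2; have c0 : 0 < c by exact: exprn_gt0.
have cN x : `|c^-1 * x| = c^-1 * `|x| by rewrite normrM gtr0_norm ?invr_gt0.
pose v h : R := c^-1 * (gr_coef (L ^+ n.*2) (h^-1 * 1)%g)%:~R.
have := small v; rewrite /v cN invg1 mulg1.
have -> : gr_coef (L ^+ n.*2) 1%g = normsq (L ^+ n).
  by rewrite /normsq gr_starX gapL_star -exprD addnn.
rewrite ger0_norm ?ler0z ?normsq_ge0 // ler_pdivrMl // -/c [eps * c]mulrC; apply.
  move=> h; rewrite cN ler_pdivrMl // mulr1 normE ?(ltW c0) //.
  have := gap_mass_le1 n.*2; rewrite /gap_mass ler_pdivrMr ?exprn_gt0 // mul1r.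
  by rewrite /c -exprM muln2.
move=> h; rewrite /conv evZv [ev _ _](conv_coef f (L ^+ n.*2) 1%g h).
rewrite cN ler_pdivrMl // normE ?mulr_ge0 ?(ltW c0) ?(ltW d0) //.
by rewrite exprMn /c -exprM muln2 mulrC.
Qed.

End Decay.

(** The error of the inverse [a / K] is a normalized power of [gapR], which has
    the same l2 norm as that of [gapL]: the trace carries the information from
    [f^* f], which injectivity controls, to [f f^*]. *)
Lemma approx_right_inverse (eps : R) : 0 < eps -> exists (K : R) (a : ZG),
  0 < K /\ forall k, `|(gr_coef (f * a) k)%:~R - K * (k == 1%g)%:R| <= eps * K.
Proof.
have [M M1 fM] := normsqM_bounded (gr_star f).
move=> e0; have [n en] := gap_decay M1 fM (exprn_gt0 2 e0).
have [a fa] := gapR_range f M n.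
have MR0 : 0 < M%:~R :> R by rewrite ltr0z; exact: lt_le_trans ltr01 M1.
exists (M%:~R ^+ n), a; split=> [|k]; first exact: exprn_gt0.
rewrite fa gr_coefB intrB.
have -> : gr_coef ((M ^+ n)%:~R : ZG) k = M ^+ n * (k == 1%g)%:R.
  rewrite -[LHS]/(gr_coef_at k _) raddfMz /= /gr_coef_at gr_deltaE.
  by rewrite mulrzz mulrC.
rewrite intrM rmorphXn /= natz -pmulrn addrAC subrr sub0r normrN.
rewrite -(@ler_pXn2r _ 2) ?nnegrE // ?mulr_ge0 ?exprn_ge0 ?(ltW e0) ?(ltW MR0) //.
rewrite real_normK ?num_real // exprMn -exprM muln2; apply: le_trans en.
by rewrite -rmorphXn ler_int -normsq_gapR sqr_coef_le_normsq.
Qed.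

(** For a finite set [F] the truncation of [e] to [F] is solved approximately by
    a combination [u] of translates of the approximate right inverse.  A priori
    the sup norm of [u] depends on [F], but [conv f u] is bounded by [2 B], and
    so the lower bound for [conv f] makes it uniform. *)
Lemma conv_surj : exists2 C : R, 0 < C & forall (e : Gamma -> R) B, 0 < B ->
  (forall h, `|e h| <= B) ->
  exists2 z, (forall h, conv f z h = e h) & forall h, `|z h| <= C * B.
Proof.
have [C C0 below] := conv_bounded_below.
exists (C * 2); first by rewrite mulr_gt0.
move=> e B B0 eB.
have [|v [vB _ ve]] := @bounded_solution R Gamma f (C * 2 * B) 0 e; last first.
  by exists v.
move=> F delta d0.
pose E := \sum_(m <- F) `|e m| + 1.
have E0 : 0 < E by apply: ltr_pwDr => //; exact: sumr_ge0.
pose d := Num.min delta B.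
have d_gt0 : 0 < d by rewrite lt_min d0.
have [|K [a [K0 Ka]]] := @approx_right_inverse (d / E); first exact: divr_gt0.
pose u h : R := \sum_(m <- F) (e m / K) * (gr_coef a (h^-1 * m)%g)%:~R.
have ue h : `|conv f u h - (h \in F)%:R * e h| <= d.
  rewrite /conv ev_sumv.
  under eq_bigr => m _ do rewrite evZv [ev _ _](conv_coef f a m h).
  have -> : (h \in F)%:R * e h =
      \sum_(m <- F) (e m / K) * (K * (h^-1 * m == 1)%g%:R).
    have delta_sum m :
        (e m / K) * (K * (h^-1 * m == 1)%g%:R) = e m * (h == m)%:R.
      rewrite -[in LHS](inj_eq (mulgI h)) mulVKg mulg1 eq_sym.
      by rewrite mulrA divfK // gt_eqF.
    under eq_bigr do rewrite delta_sum.
    case: (boolP (h \in F)) => hF.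
      rewrite (big_fsetD1 h) //= eqxx mulr1 mul1r big1_seq ?addr0 // => m.
      by rewrite /= in_fsetD1 eq_sym => /andP[/negPf-> _]; rewrite mulr0.
    rewrite mul0r big1_seq // => m /= mF.
    by case: eqP => [hm|]; [rewrite hm mF in hF|rewrite mulr0].
  rewrite -sumrB.
  under eq_bigr do rewrite -mulrBr.
  apply: le_trans (ler_norm_sum _ _ _) _.
  apply: (@le_trans _ _ (\sum_(m <- F) `|e m| * (d / E))).
    apply: ler_sum => m _; rewrite 2!normrM normfV (gtr0_norm K0) -mulrA.
    by rewrite ler_wpM2l // ler_pdivrMl // [K * (d / E)]mulrC.
  rewrite -mulr_suml mulrCA ler_piMr ?(ltW d_gt0) //.
  by rewrite ler_pdivrMr // mul1r /E lerDl.
(* Any bound will do here: it is only used to know that [u] is bounded. *)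
have uS h : `|u h| <= \sum_(m <- F) `|e m / K| * ((normsq a)%:~R + 1).
  apply: le_trans (ler_norm_sum _ _ _) _; apply: ler_sum => m _.
  rewrite normrM ler_wpM2l //.
  have := sqr_coef_le_normsq a (h^-1 * m)%g; rewrite -(ler_int R) rmorphXn /=.
  rewrite -[(_%:~R) ^+ 2]real_normK ?num_real //; set t := `|_|; nra.
exists u; split=> // [h|h hF].
  rewrite -mulrA; apply: (below _ _ _ _ uS) => [|k]; first by rewrite mulr_gt0.
  rewrite -[conv f u k](subrK ((k \in F)%:R * e k)).
  apply: le_trans (ler_normD _ _) _; rewrite [2 * B]mulr_natl mulr2n lerD //.
    by apply: le_trans (ue k) _; rewrite ge_min lexx orbT.
  by case: (k \in F); rewrite ?mul1r // mul0r normr0 ltW.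
by have := ue h; rewrite hF mul1r => /le_trans; apply; rewrite ge_min lexx.
Qed.

End BoundedInverse.

(** * The circle *)

Section CircleTheory.
Context {R : realType}.
Implicit Types (s t : R) (c : circle R).
Local Open Scope quotient_scope.

Definition circle_pi t : circle R := \pi_{ideal_quot int_subgroup_zmod R} t.

Definition circle_repr c : R := repr (c : {ideal_quot int_subgroup_zmod R}).

Lemma circle_reprK : cancel circle_repr circle_pi.
Proof. by move=> c; exact: reprK. Qed.

Fact circle_pi_zmod_morphism : zmod_morphism circle_pi.
Proof. by move=> s t; exact: (raddfB (\pi_{ideal_quot int_subgroup_zmod R})). Qed.

HB.instance Definition _ :=
  GRing.isZmodMorphism.Build R (circle R) circle_pi circle_pi_zmod_morphism.

Lemma circle_pi_eq0 t : circle_pi t = 0 <-> t \is a Num.int.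
Proof.
have E := @Quotient.idealrBE R (int_subgroup_zmod R) t 0; rewrite subr0 in E.
rewrite -(raddf0 circle_pi); split=> [t0|tZ].
  by change (t \in int_subgroup_zmod R); rewrite E; apply/eqP.
change (is_true (t \in int_subgroup_zmod R)) in tZ; rewrite E in tZ.
exact: (eqP tZ).
Qed.

Lemma circle_pi_continuous : continuous circle_pi.
Proof. exact: pi_continuous. Qed.

(** The image of the open interval of radius [eta] around 0; these sets replace
    the metric of the circle. *)
Definition near_zero (eta : R) c := exists2 s, `|s| < eta & c = circle_pi s.

Lemma near_zero_pi eta s : `|s| < eta -> near_zero eta (circle_pi s).
Proof. by exists s. Qed.

Lemma near_zeroB e1 e2 c1 c2 : near_zero e1 c1 -> near_zero e2 c2 ->
  near_zero (e1 + e2) (c1 - c2).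
Proof.
move=> [s1 s1e ->] [s2 s2e ->]; exists (s1 - s2); last by rewrite raddfB.
by apply: le_lt_trans (ler_normB _ _) _; exact: ltrD.
Qed.

Lemma near_zeroN eta c : near_zero eta c -> near_zero eta (- c).
Proof. by move=> [s se ->]; exists (- s); rewrite ?normrN ?raddfN. Qed.

Lemma near_zero_0 eta : 0 < eta -> near_zero eta 0.
Proof. by move=> e0; exists 0; rewrite ?normr0 ?raddf0. Qed.

Lemma near_zeroW e1 e2 c : e1 <= e2 -> near_zero e1 c -> near_zero e2 c.
Proof. by move=> e12 [s se ->]; exists s => //; exact: lt_le_trans e12. Qed.

Lemma near_zero_lift eta c t : near_zero eta (c - circle_pi t) ->
  exists2 s, `|s - t| < eta & c = circle_pi s.
Proof.
move=> [s se ct]; exists (s + t); first by rewrite addrK.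
by rewrite raddfD /= -ct subrK.
Qed.

Lemma nbhs_circle c (O : set (circle R)) : nbhs c O ->
  exists2 eta : R, 0 < eta & forall c', near_zero eta (c' - c) -> O c'.
Proof.
rewrite -{1}(circle_reprK c) => /circle_pi_continuous.
rewrite /= => /nbhs_ballP[eta /= e0 eO]; exists eta => // c'.
rewrite -{1}(circle_reprK c) => /near_zero_lift[s se ->]; apply: eO.
by rewrite /ball /= distrC.
Qed.

Lemma open_near_zero eta c : open [set c' | near_zero eta (c' - c)].
Proof.
suff : open (circle_pi @^-1` [set c' | near_zero eta (c' - c)]) by [].
rewrite openE => t /= tc.
have [s se cs] := tc.
apply/nbhs_ballP; exists (eta - `|s|); first by rewrite /= subr_gt0.
move=> t' /=; rewrite /ball /= => tt'.
exists (s + (t' - t)); last first.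
  by rewrite raddfD /= raddfB /= -cs [RHS]addrC addrA subrK.
apply: le_lt_trans (ler_normD _ _) _.
by rewrite -ltrBrDl distrC.
Qed.

End CircleTheory.

(** * Points of the principal action and their coordinates *)

Section Characters.
Context {R : realType} {Gamma : groupType} {f : group_ring Gamma}.
Local Notation ZG := (group_ring Gamma).
Local Notation X := (principal_space R f).
Implicit Types (a b : ZG) (x y : X) (t : Gamma -> R) (g h : Gamma).

Lemma cyclic_piB a b : cyclic_pi f (a - b) = cyclic_pi f a - cyclic_pi f b.
Proof. by apply/eqP; rewrite eq_sym subr_eq -cyclic_piD subrK. Qed.

(** A character of ZGamma / ZGamma f, lifted to the group ring. *)
Definition char_val x a : circle R := discrete_dual_fun x (cyclic_pi f a).

Fact char_val_zmod_morphism x : zmod_morphism (char_val x).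
Proof.
move=> a b; rewrite /char_val -[RHS](raddfB (x : {additive _ -> circle R})).
by rewrite cyclic_piB.
Qed.

HB.instance Definition _ x :=
  GRing.isZmodMorphism.Build ZG (circle R)
    (char_val x) (char_val_zmod_morphism x).

Definition char_coord x g : circle R := char_val x (gr_delta g).

Lemma char_val_mulf x a : char_val x (a * f) = 0.
Proof.
rewrite /char_val (_ : cyclic_pi f (a * f) = 0).
  exact: (raddf0 (x : {additive _ -> circle R})).
have -> : cyclic_pi f (a * f) = cyclic_pi f 0.
  by apply/cyclic_pi_eq; exists a; rewrite subr0.
by apply: (addrI (cyclic_pi f 0)); rewrite -cyclic_piD !addr0.
Qed.

Lemma char_coord_act g h x :
  char_coord (principal_action g x) h = char_coord x (g^-1 * h)%g.
Proof.
rewrite /char_coord /char_val /principal_action dual_actE; congr discrete_dual_fun.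
by rewrite -[LHS]/(cyclic_scale _ _) cyclic_scale_pi -gr_deltaM.
Qed.

Lemma char_val_lift x t : (forall h, circle_pi (t h) = char_coord x h) ->
  forall a, circle_pi (ev t a) = char_val x a.
Proof.
move=> tx; apply: gr_ind => [a b IHa IHb|g]; first by rewrite !raddfB /= IHa IHb.
by rewrite ev_delta tx.
Qed.

Lemma lift_conv_int x t h : (forall h, circle_pi (t h) = char_coord x h) ->
  conv f t h \is a Num.int.
Proof.
move=> tx; apply/circle_pi_eq0.
by rewrite -ev_mul_delta (char_val_lift tx) char_val_mulf.
Qed.

Section CharOf.
Variable t : Gamma -> R.
Hypothesis t_int : forall h, conv f t h \is a Num.int.

Lemma ev_mulf_int a : ev t (a * f) \is a Num.int.
Proof.
move: a; apply: gr_ind => [a b IHa IHb|g]; last by rewrite ev_mul_delta.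
by rewrite mulrBl raddfB /= rpredB.
Qed.

(** Well defined modulo ZGamma f because [ev t] is integral there. *)
Definition char_of_fun (m : cyclic_module f) : circle R :=
  circle_pi (ev t (cyclic_repr m)).

Lemma char_of_fun_pi a : char_of_fun (cyclic_pi f a) = circle_pi (ev t a).
Proof.
have [c ac] := (cyclic_pi_eq f _ _).1 (cyclic_reprK (cyclic_pi f a)).
apply: subr0_eq; rewrite /char_of_fun -!raddfB /= ac.
by apply/circle_pi_eq0; exact: ev_mulf_int.
Qed.

Fact char_of_fun_zmod_morphism : zmod_morphism char_of_fun.
Proof.
move=> m n; rewrite -[m](cyclic_reprK) -[n](cyclic_reprK).
set a := cyclic_repr m; set b := cyclic_repr n.
by rewrite -cyclic_piB !char_of_fun_pi !raddfB.
Qed.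

HB.instance Definition _ := GRing.isZmodMorphism.Build (cyclic_module f)
  (circle R) char_of_fun char_of_fun_zmod_morphism.

Definition char_of : X :=
  GRing.Additive.clone (cyclic_module f) (circle R) char_of_fun _.

Lemma char_coord_char_of h : char_coord char_of h = circle_pi (t h).
Proof. by rewrite -[LHS]/(char_of_fun _) char_of_fun_pi ev_delta. Qed.

End CharOf.

Lemma nbhs_char_coord x g (eta : R) : 0 < eta ->
  nbhs x [set y | near_zero eta (char_coord y g - char_coord x g)].
Proof.
move=> e0; pose O := [set c | near_zero eta (c - char_coord x g)].
pose K : set (discrete_topology (cyclic_module f)) :=
  [set cyclic_pi f (gr_delta g)].
have oO : open O by exact: open_near_zero.
have KO : nbhs (discrete_dual_fun x) [set psi | psi @` K `<=` O].
  apply: open_nbhs_nbhs; split.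
    by apply: compact_open_open => //; exact: compact_set1.
  by move=> _ [_ -> <-]; rewrite /O /= subrr; exact: near_zero_0.
move: KO => /initial_continuous; apply: (@filterS _ _ (nbhs_filter x)).
by move=> y; apply; exists (cyclic_pi f (gr_delta g)).
Qed.

(** The compact-open topology is that of coordinatewise convergence: compact
    subsets of a discrete group are finite, and every element of the group ring
    is a finite combination of group elements. *)
Lemma char_cvg (G : set_system X) x : Filter G ->
  (forall g eta, 0 < eta ->
    G [set y | near_zero eta (char_coord y g - char_coord x g)]) ->
  G --> x.
Proof.
move=> FG Gx.
have Gval a eta : 0 < eta ->
    G [set y | near_zero eta (char_val y a - char_val x a)].
  move: a eta; apply: gr_ind => [a b IHa IHb|g] eta e0; last exact: Gx.
  have e20 : 0 < eta / 2 by rewrite divr_gt0.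
  apply: filterS2 (IHa _ e20) (IHb _ e20) => y ya yb.
  rewrite /= [eta]splitr !raddfB /=.
  have := near_zeroB ya yb; congr near_zero.
  by rewrite !opprD !opprK addrACA.
have dualG : discrete_dual_fun y @[y --> G] --> discrete_dual_fun x.
  apply/compact_open_cvgP => K O cK oO xKO.
  have : \near G, K `<=` (fun m => O (discrete_dual_fun G m)).
    move/compact_near_coveringP : cK; apply => m Km.
    have /nbhs_circle[eta e0 etaO] : nbhs (discrete_dual_fun x m) O.
      by apply: open_nbhs_nbhs; split=> //; apply: xKO; exists m.
    have Gm := Gval (cyclic_repr m) eta e0.
    exists ([set m], [set y | near_zero eta (char_val y (cyclic_repr m)
        - char_val x (cyclic_repr m))]) => /=.
      by split=> //; exact: discrete_set1.
    move=> [_ y] /= [-> ym]; apply: etaO.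
    by move: ym; rewrite /char_val cyclic_reprK.
  by apply: filterS => y yK _ [m Km <-]; exact: yK.
move=> A [_ [[B Bop <-] Bx BA]]; apply: filterS BA _.
by apply: dualG; exact: open_nbhs_nbhs.
Qed.

End Characters.

(** * Compactness and the comparison of uniformities *)

Section CircleLift.
Context {R : realType}.
Implicit Types (c : circle R).

Definition circle_lift c : R := circle_repr c - (Num.floor (circle_repr c))%:~R.

Lemma circle_liftK : cancel circle_lift circle_pi.
Proof.
move=> c; rewrite /circle_lift raddfB /= circle_reprK.
by rewrite (circle_pi_eq0 _).2 ?subr0 // intr_int.
Qed.

Lemma circle_lift_bounded c : `|circle_lift c| <= 1.
Proof.
have /andP[lo hi] := floor_itv (circle_repr c).
by rewrite ler_norml /circle_lift; rewrite intrD in hi; apply/andP; lra.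
Qed.

Lemma int_norm_lt1 (r : R) : r \is a Num.int -> `|r| < 1 -> r = 0.
Proof.
move=> rZ r1; apply/eqP; apply: contraTT r1 => r0.
by rewrite -leNgt norm_intr_ge1.
Qed.

(** Integers at distance less than 1 are equal, so the function is constant on a
    set of the filter. *)
Lemma int_cvg (T : Type) (F : set_system T) (g : T -> R) (l : R) :
  ProperFilter F -> (forall x, g x \is a Num.int) -> g @ F --> l ->
  l \is a Num.int.
Proof.
move=> FF gZ gl; have h0 : 0 < 1 / 2 :> R by rewrite divr_gt0.
have [x0 /= lx0] := filter_ex (cvgr_dist_lt _ _ gl _ h0).
suff -> : l = g x0 by [].
apply/eqP; rewrite -subr_eq0 -normr_le0; apply/ler_addgt0Pl => e e0.
have m0 : 0 < Num.min e (1 / 2) by rewrite lt_min e0.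
have [x /= ] := filter_ex (cvgr_dist_lt _ _ gl _ m0); rewrite lt_min => /andP[lxe lx].
rewrite addr0; apply: ltW; rewrite (_ : g x0 = g x) //.
apply: subr0_eq; apply: int_norm_lt1; first exact: rpredB.
rewrite [1]splitr; apply: le_lt_trans (ler_distD l _ _) _.
by rewrite ltrD // distrC.
Qed.

End CircleLift.

Section Compactness.
Context {R : realType} {Gamma : groupType} {f : group_ring Gamma}.
Local Notation X := (principal_space R f).
Implicit Types (x y : X) (g h : Gamma).

(** Lift the coordinates of a point to reals in [-1, 1] and take limits along an
    ultrafilter: the limit family still has an integral convolution, so it
    represents a point. *)
Lemma principal_space_compact : compact [set: X].
Proof.
rewrite compact_ultra => U UU _; have UP : ProperFilter U by exact: ultra_proper.
pose w x g := circle_lift (char_coord x g).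
have /choice[t wt] : forall g, exists l : R, (fun x => w x g) @ U --> l.
  move=> g; have [|l _ Ul] := @ultra_bounded_cvg R X U (fun x => w x g) 1 UU.
    by apply: filterS filterT => x _; exact: circle_lift_bounded.
  by exists l.
have t_int h : conv f t h \is a Num.int.
  apply: (@int_cvg _ X U (fun x => conv f (w x) h)) => [x|].
    by apply: (@lift_conv_int _ _ _ x) => k; exact: circle_liftK.
  by apply: ev_cvg => k; exact: wt.
exists (char_of t_int); split=> //; apply: char_cvg => g eta e0.
rewrite char_coord_char_of.
apply: filterS (cvgr_distC_lt _ _ (wt g) _ e0) => x wx.
by rewrite /= -(circle_liftK (char_coord x g)) -raddfB; exact: near_zero_pi.
Qed.

Variable d : X -> X -> R.
Hypothesis d_compatible : compatible_metric d.

Lemma nbhs_metric x (e : R) : 0 < e -> nbhs x [set y | d x y < e].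
Proof. by move=> e0; apply/(metric_nbhsP d_compatible); exists e. Qed.

(** One half of the uniqueness of the uniformity of a compact space; the near
    covering property lets [delta] be chosen independently of [x]. *)
Lemma metric_near_zero g (eta : R) : 0 < eta -> exists2 delta : R, 0 < delta &
  forall x y, d x y < delta -> near_zero eta (char_coord y g - char_coord x g).
Proof.
move=> e0; have cX := principal_space_compact.
have e20 : 0 < eta / 2 by rewrite divr_gt0.
have : \forall delta \near 0^'+, [set: X] `<=`
    (fun x => forall y, d x y < delta ->
      near_zero eta (char_coord y g - char_coord x g)).
  move/compact_near_coveringP : cX; apply => x _.
  have /(metric_nbhsP d_compatible)[e ep xe] := nbhs_char_coord x g e20.
  have ep2 : 0 < e / 2 by rewrite divr_gt0.
  exists ([set x' | d x x' < e / 2], [set delta | delta < e / 2]) => /=.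
    by split; [exact: nbhs_metric|exact: nbhs_right_lt].
  move=> [x' delta] /= [xx' de] y x'y.
  have xy : d x y < e.
    apply: le_lt_trans (metric_trian d_compatible x x' y) _.
    by rewrite [e]splitr ltrD // (lt_trans x'y).
  have xx'e : d x x' < e.
    by apply: lt_trans xx' _; rewrite ltr_pdivrMr // ltr_pMr // ltr1n.
  have := near_zeroB (xe _ xy) (xe _ xx'e); rewrite -splitr; congr near_zero.
  by rewrite opprB addrA subrK.
move=> near_delta.
have [delta [/= d0 dX]] := filter_ex (filterI (nbhs_right_gt (0 : R)) near_delta).
by exists delta => // x y; exact: dX.
Qed.

Section Close.
Variable c : Gamma -> nat.
Hypothesis c_inj : injective c.

(** With [c] an enumeration of the group, the sets [close n] form a countable
    base of the uniformity of coordinatewise convergence. *)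
Definition close n x y :=
  forall g, (c g <= n)%N -> near_zero n.+1%:R^-1 (char_coord y g - char_coord x g).

Lemma closeW m n x y : (m <= n)%N -> close n x y -> close m x y.
Proof.
move=> mn xy g gm; apply: near_zeroW (xy g (leq_trans gm mn)).
by rewrite lef_pV2 ?posrE ?ltr0n // ler_nat.
Qed.

Lemma finite_index n : finite_set [set g | (c g <= n)%N].
Proof.
have fI : finite_set (`I_n.+1 : set nat) by exact: finite_II.
apply: (@sub_finite_set _ _ (c @^-1` `I_n.+1)) => [g //|].
by apply: finite_preimage => // g h _ _; exact: c_inj.
Qed.

Lemma nbhs_close n x : nbhs x [set y | close n x y].
Proof.
have := finite_index n => /finite_fsetP[S SE].
have : nbhs x (\bigcap_(g in [set` S])
    [set y | near_zero n.+1%:R^-1 (char_coord y g - char_coord x g)]).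
  by apply: filter_bigI => g _; apply: nbhs_char_coord; rewrite invr_gt0 ltr0n.
apply: (@filterS _ _ (nbhs_filter x)) => y yS g gn; apply: (yS g).
by rewrite -SE.
Qed.

Lemma close_nbhs x (A : set X) : nbhs x A -> exists n, close n x `<=` A.
Proof.
pose G := filter_from [set: nat] (fun n => close n x).
have FG : Filter G.
  apply: filter_from_filter; first by exists 0%N.
  move=> m n _ _; exists (maxn m n) => // y xy.
  by split; apply: closeW xy; rewrite ?leq_maxl ?leq_maxr.
have Gx : G --> x.
  apply: char_cvg => g eta e0.
  have [m me] : exists m : nat, eta^-1 < m%:R.
    by exists (Num.bound eta^-1); rewrite archi_boundP // invr_ge0 ltW.
  exists (maxn m (c g)) => // y xy; apply: near_zeroW (xy g (leq_maxr _ _)).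
  rewrite invf_ple ?posrE ?ltr0n //; apply: le_trans (ltW me) _.
  by rewrite ler_nat (leq_trans (leq_maxl m (c g))).
by move=> /Gx[n _ nA]; exists n.
Qed.

(** The other half of the uniqueness of the uniformity. *)
Lemma close_metric (e : R) : 0 < e ->
  exists n, forall x y, close n x y -> d x y < e.
Proof.
move=> e0; have cX := principal_space_compact.
have e20 : 0 < e / 2 by rewrite divr_gt0.
have : \forall n \near \oo, [set: X] `<=`
    (fun x => forall y, close n x y -> d x y < e).
  move/compact_near_coveringP : cX; apply => x _.
  have [n0 xn0] := close_nbhs (nbhs_metric x e20).
  (* Chosen so that the radius [1 / (n1 + 1)] is half of [1 / (n0 + 1)]. *)
  pose n1 := (n0.*2.+1)%N.
  exists ([set x' | close n1 x x'], [set n | (n1 <= n)%N]) => /=.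
    by split; [exact: nbhs_close|exact: nbhs_infty_ge].
  move=> [x' n] /= [xx' n1n] y x'y.
  have n01 : (n0 <= n1)%N by rewrite /n1 -addnn leqW // leq_addr.
  have xx'e := xn0 _ (closeW n01 xx').
  have xye : d x y < e / 2.
    apply: xn0 => g gn0; have gn1 := leq_trans gn0 n01.
    have := near_zeroB ((closeW n1n x'y) g gn1) (near_zeroN (xx' g gn1)).
    have -> : n1.+1%:R^-1 + n1.+1%:R^-1 = n0.+1%:R^-1 :> R.
      by rewrite /n1 -doubleS -muln2 natrM invfM [RHS]splitr.
    by rewrite opprK addrA subrK.
  apply: le_lt_trans (metric_trian d_compatible x' x y) _.
  by rewrite [e]splitr ltrD // (metric_symm d_compatible).
by move=> /filter_ex[n nX]; exists n => x y; exact: nX.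
Qed.

End Close.
End Compactness.

(** * Pseudo-orbit tracing *)

Section Tracing.
Context {R : realType} {Gamma : groupType} {f : group_ring Gamma}.
Local Notation X := (principal_space R f).
Implicit Types (x y : X) (g h : Gamma).
Variables (d : X -> X -> R).
Hypothesis d_compatible : compatible_metric d.
Variable c : Gamma -> nat.
Hypothesis c_inj : injective c.

(** A non-zero bounded kernel vector, scaled to size less than 1 and small
    compared with the expansiveness constant, represents a non-zero point whose
    whole orbit stays close to the zero point. *)
Lemma expansive_conv_inj : expansive d (@principal_action R Gamma f) ->
  forall (v : Gamma -> R) B, (forall h, `|v h| <= B) ->
  (forall h, conv f v h = 0) -> forall h, v h = 0.
Proof.
move=> [e e0 expd] v B vB fv h; apply/eqP; apply: contraT => vh.
have [n nd] := close_metric d_compatible c_inj e0.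
have B0 : 0 <= B by apply: le_trans (vB 1%g).
pose l : R := n.+2%:R^-1 / (B + 1).
have l0 : 0 < l by rewrite divr_gt0 ?invr_gt0 ?ltr0n // ltr_wpDl.
have lv k : `|l * v k| < n.+1%:R^-1.
  rewrite normrM gtr0_norm // /l -mulrA -[ltRHS]mulr1.
  apply: ltr_pM.
  - by rewrite invr_ge0 ler0n.
  - by rewrite mulr_ge0 ?invr_ge0 ?addr_ge0.
  - by rewrite ltf_pV2 ?posrE ?ltr0n // ltr_nat.
  - by rewrite ltr_pdivrMl ?ltr_wpDl // mulr1 (le_lt_trans (vB k)) // ltrDl.
have conv0 k : conv f (fun=> 0 : R) k \is a Num.int.
  rewrite (_ : conv f _ k = 0) ?rpred0 // /conv /ev big1 // => ? _.
  by rewrite mulr0.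
have convl k : conv f (fun k => l * v k) k \is a Num.int.
  by rewrite /conv evZv [ev _ _](fv k) mulr0 rpred0.
have lvh : l * v h != 0 by rewrite mulf_neq0 // gt_eqF.
have [g] : exists g, e < d (principal_action g (char_of conv0))
                           (principal_action g (char_of convl)).
  apply: expd => /(congr1 (char_coord^~ h)); rewrite !char_coord_char_of raddf0.
  move=> /esym/circle_pi_eq0/int_norm_lt1 lv0.
  move: lvh; rewrite lv0 ?eqxx //; apply: lt_le_trans (lv h) _.
  by rewrite invf_le1 ?ltr0n // ler1n.
rewrite ltNge => /negP[]; apply/ltW/nd => k _.
rewrite !char_coord_act !char_coord_char_of raddf0 subr0.
exact: near_zero_pi.
Qed.

(** The point that traces has coordinates [t - z], where [t_h] is a lift of the
    coordinate of [x_ h^-1] at the identity and [conv f z] is the difference of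
    [conv f t] and an integral family. *)
Lemma principal_pseudo_orbit_tracing :
  expansive d (@principal_action R Gamma f) ->
  pseudo_orbit_tracing d (@principal_action R Gamma f).
Proof.
move=> /expansive_conv_inj/conv_surj[C C0 surj] eps eps0.
have [n nd] := close_metric d_compatible c_inj eps0.
have [D D0 evD] := @ev_bounded R Gamma f.
(* The final error is [|z| + eta], where [|z| <= C D eta]; the remaining [eta]
   makes the inequality strict. *)
pose eta : R := n.+1%:R^-1 / (C * D + 2).
have CD0 : 0 < C * D + 2 by rewrite ltr_pwDr // mulr_ge0 ?ltW.
have eta0 : 0 < eta by rewrite divr_gt0 ?invr_gt0 ?ltr0n.
have [delta delta0 near_orbit] := metric_near_zero d_compatible 1%g eta0.
(* The first set makes the defect of [t] small, the second one compares the
   finitely many coordinates that matter for the metric. *)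
exists delta, ([set s | s^-1%g \in finsupp f] `|` [set s | (c s^-1%g <= n)%N]).
split=> // [|x_ orbit].
  rewrite finite_setU; split; last first.
    apply: (@finite_preimage _ _ _ (fun s : Gamma => s^-1%g))
      (finite_index c_inj n).
    by move=> s s' _ _; exact: invg_inj.
  apply: (@finite_preimage _ _ [set` finsupp f] (fun s : Gamma => s^-1%g))
    (finite_fset _).
  by move=> s s' _ _; exact: invg_inj.
have {}orbit k g : k \in finsupp f \/ (c k <= n)%N ->
    near_zero eta (char_coord (x_ (k^-1 * g)%g) 1%g - char_coord (x_ g) k).
  move=> kS; have /orbit/(_ g)/near_orbit : ([set s | s^-1%g \in finsupp f]
      `|` [set s | (c s^-1%g <= n)%N]) k^-1%g.
    by case: kS => kS; [left|right]; rewrite /= invgK.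
  by rewrite char_coord_act invgK mulg1.
pose t h := circle_lift (char_coord (x_ h^-1%g) 1%g).
(* Compare [t] near [h] with a lift [s] of the coordinates of the point
   [x_ h^-1], for which the pairing with [f] is an integer. *)
have defect h : exists e : R, `|e| <= D * eta /\ conv f t h - e \is a Num.int.
  have /choice[s sP] : forall k, exists s : R,
      circle_pi s = char_coord (x_ h^-1%g) k /\
      (k \in finsupp f -> `|t (h * k)%g - s| <= eta).
    move=> k; case: (boolP (k \in finsupp f)) => kf; last first.
      by exists (circle_lift (char_coord (x_ h^-1%g) k)); rewrite circle_liftK.
    have /near_zeroN := orbit k h^-1%g (or_introl kf).
    rewrite opprB -invgM -{1}(circle_liftK (char_coord (x_ _) 1%g)).
    by move=> /near_zero_lift[s st ->]; exists s; split=> // _; rewrite distrC ltW.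
  exists (conv f t h - ev s f); split; last first.
    rewrite opprB addrC subrK; apply/circle_pi_eq0.
    rewrite (@char_val_lift _ _ _ (x_ h^-1%g)) => [|k]; last exact: (sP k).1.
    by rewrite -[f in X in char_val _ X]mul1r char_val_mulf.
  by rewrite -evBv; apply: evD => [|k /(sP k).2 //]; exact: ltW.
have /choice[e eP] := defect.
have [||z fz zB] := surj e (D * eta); first by rewrite mulr_gt0.
  by move=> h; exact: (eP h).1.
pose t' h := t h - z h.
have t'_int h : conv f t' h \is a Num.int.
  by rewrite /conv evBv [X in _ - X](fz h) (eP h).2.
exists (char_of t'_int) => g; apply: nd => h hn.
rewrite char_coord_act char_coord_char_of /t' raddfB /=.
have := orbit h g (or_intror hn).
rewrite (_ : char_coord (x_ (h^-1 * g)%g) 1%g =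
             circle_pi (t (g^-1 * h)%g)); last first.
  by rewrite /t circle_liftK invgM invgK.
have zeta : `|z (g^-1 * h)%g| < (C * D + 1) * eta.
  apply: le_lt_trans (zB _) _; rewrite mulrA mulrDl mul1r ltrDl //.
move=> /(near_zeroB (near_zero_pi zeta)).
have -> : (C * D + 1) * eta + eta = n.+1%:R^-1.
  by rewrite -[X in _ + X]mul1r -mulrDl -addrA /eta mulrC divfK // gt_eqF.
by congr near_zero; rewrite !opprB addrC addrA addrAC.
Qed.

End Tracing.

Theorem theorem1p5 (R : realType) (Gamma : groupType)
    (Gamma_countable : countable [set: Gamma]%classic)
    (f : group_ring Gamma)
    (d : principal_space R f -> principal_space R f -> R)
    (d_compatible : compatible_metric d) :
  expansive d (@principal_action R Gamma f) ->
  pseudo_orbit_tracing d (@principal_action R Gamma f).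
Proof.
have /countable_injP[c c_inj] := Gamma_countable.
apply: (principal_pseudo_orbit_tracing d_compatible (c := c)).
by move=> g h; apply: c_inj; rewrite inE.
Qed.
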